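(* Let $p$ be a prime and let $(\Omega,S)$ be a coherent configuration all of whose fibers $\Delta$ satisfy $(\Delta,S_\Delta)\simeq C_p\wr C_p$. Suppose that $|s|=p^3$ for each $s\in S$ with $\sigma_s\sigma_s=0$. Then either $|\Omega|\le p^2(p+1)$, or $ss^\ast s=\{s\}$ for each $s\in S$.
   Context: A coherent configuration is a pair $(\Omega,S)$ of a finite set $\Omega$ and a partition $S$ of $\Omega\times\Omega$ such that $1_\Omega$ is a union of elements of $S$, $s^\ast:=\{(\beta,\alpha)\mid(\alpha,\beta)\in s\}\in S$ for $s\in S$, and $\sigma_s\sigma_t=\sum_{u\in S}c_{st}^u\sigma_u$ with nonnegative integers $c_{st}^u$, where $\sigma_u$ is the $\Omega\times\Omega$ adjacency (0/1) matrix of $u$. A fiber is a subset $\Delta\subseteq\Omega$ with $1_\Delta\in S$; $S_\Delta:=\{s\in S\mid s\subseteq\Delta\times\Delta\}$, and $(\Delta,S_\Delta)$ is an association scheme. The complex product of $T,U\subseteq S$ is $TU:=\{s\in S\mid c_{tu}^s>0$ for some $t\in T,u\in U\}$, singletons written without braces. $C_p\wr C_p$ denotes the association scheme with point set $\mathbb{Z}_p\times\mathbb{Z}_p$ and relations $\{((x,y),(x+a,y))\mid x,y\in\mathbb{Z}_p\}$ for $a\in\mathbb{Z}_p$ and $\{((x_1,y),(x_2,y+b))\mid x_1,x_2,y\in\mathbb{Z}_p\}$ for $b\in\mathbb{Z}_p\setminus\{0\}$ (the wreath product of the thin scheme of $C_p$ by itself). *)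

(* Defs.v *)
From HB Require Import structures.
From mathcomp Require Import all_boot all_order all_algebra.
Set Implicit Arguments.
Unset Strict Implicit.
Unset Printing Implicit Defensive.
Import Order.TTheory GRing.Theory Num.Theory.
Local Open Scope ring_scope.

(* 1_Delta *)
Definition diag_rel (Omega : finType) (Delta : {set Omega}) :
  {set Omega * Omega} := [set (x, x) | x in Delta].

(* s^* *)
Definition conv_rel (Omega : finType) (s : {set Omega * Omega}) :
  {set Omega * Omega} := [set q | (q.2, q.1) \in s].

(* Rows and columns are indexed by Omega through its enumeration. *)
Definition adjmx (Omega : finType) (s : {set Omega * Omega}) :
  'M[int]_#|Omega| :=
  \matrix_(i, j) ((enum_val i, enum_val j) \in s)%:R.

(* The structure constants [intnum s t u] = c_{st}^u are uniquely determined
   for s, t, u in [rels]; outside [rels] their values are irrelevant.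
   [partition] includes the requirement that no block is empty. *)
Record coherent_configuration (Omega : finType) := CoherentConfiguration {
  rels : {set {set Omega * Omega}};
  intnum : {set Omega * Omega} -> {set Omega * Omega} ->
           {set Omega * Omega} -> nat;
  rels_partition : partition rels [set: Omega * Omega];
  rels_diag : exists2 T : {set {set Omega * Omega}},
    T \subset rels & diag_rel [set: Omega] = cover T;
  rels_conv : forall s, s \in rels -> conv_rel s \in rels;
  rels_mul : forall s t, s \in rels -> t \in rels ->
    adjmx s *m adjmx t = \sum_(u in rels) adjmx u *+ intnum s t u
}.

Definition fiber (Omega : finType) (C : coherent_configuration Omega)
  (Delta : {set Omega}) : bool := diag_rel Delta \in rels C.

(* S_Delta *)
Definition rels_in (Omega : finType) (C : coherent_configuration Omega)
  (Delta : {set Omega}) : {set {set Omega * Omega}} :=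
  [set s in rels C | s \subset setX Delta Delta].

Definition complex_prod (Omega : finType) (C : coherent_configuration Omega)
  (T U : {set {set Omega * Omega}}) : {set {set Omega * Omega}} :=
  [set s in rels C | [exists t in T, exists u in U, (0 < intnum C t u s)%N]].

(* Isomorphism between (X, R) and (Y, R'), where the relations in R live on
   X x X and those in R' on Y x Y: only the restriction of [f] to X matters. *)
Definition scheme_iso (A B : finType) (X : {set A}) (R : {set {set A * A}})
  (Y : {set B}) (R' : {set {set B * B}}) : Prop :=
  exists f : A -> B,
    [/\ {in X &, injective f},
        f @: X = Y &
        [set [set (f q.1, f q.2) | q in r] | r : {set A * A} in R] = R'].

(* The relations of C_p wr C_p on Z_p x Z_p; meaningful for p >= 2, since
   'Z_p is Z/2 for p < 2. *)
Definition wreath_rels (p : nat) :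
  {set {set ('Z_p * 'Z_p) * ('Z_p * 'Z_p)}} :=
  [set [set ((z.1, z.2), (z.1 + a, z.2)) | z : 'Z_p * 'Z_p] | a : 'Z_p]
  :|: [set [set ((z.1.1, z.2), (z.1.2, z.2 + b)) | z : ('Z_p * 'Z_p) * 'Z_p]
        | b in [set~ (0 : 'Z_p)]].

(* Main.v *)
Require Import Defs.
From HB Require Import structures.
From mathcomp Require Import all_boot all_order all_algebra.
From mathcomp Require Import ring.
Set Implicit Arguments.
Unset Strict Implicit.
Unset Printing Implicit Defensive.
Import Order.TTheory GRing.Theory Num.Theory.
Local Open Scope ring_scope.

(** In each fiber the thin relations form a group [C_p] whose orbits are the [p]
  blocks of the fiber. Let [s] be a relation between two distinct fibers. Its
  neighbourhoods have [p] points, and since [p] is prime they are either blocks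
  ("blocky") or transversals of the blocks. Which case occurs depends only on
  the two fibers, and both "blocky" and "not blocky" are transitive on distinct
  fibers, so one of them holds for all pairs. In the blocky case [s s* s = s].

  In the other case fix a fiber [Delta]. A relation from [Delta] to another
  fiber is encoded by a [p * p] generalized Hadamard matrix over [Z_p], which
  for each nontrivial character of [Z_p] gives an orthogonal basis of [C^p].
  These bases are mutually unbiased, and together with the standard basis there
  are at most [p + 1] of them. The bound is proved without characters: it is
  Bessel's inequality for the rank one matrix [e_0 e_1^*] and the spaces spanned
  by the rank one projections of each basis, after averaging over all
  nontrivial characters. *)

(** * Mutually unbiased generalized Hadamard matrices *)

Lemma sum_eq1 (T : finType) (x : T) : \sum_y (x == y)%:R = 1 :> int.
Proof.
rewrite (bigD1 x) //= eqxx big1 ?addr0 // => y /negPf.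
by rewrite eq_sym => ->.
Qed.

Lemma sum_eq1l (T : finType) (x : T) : \sum_y (y == x)%:R = 1 :> int.
Proof. by under eq_bigr do rewrite eq_sym; exact: sum_eq1. Qed.

Lemma sum_cst (T : finType) (c : int) : \sum_(x : T) c = #|T|%:R * c.
Proof. by rewrite sumr_const mulr_natl. Qed.

Section UnbiasedHadamard.

Variables (G : finComNzRingType) (I : finType) (H : I -> G -> G -> G).
Variable J : {set I}.
Local Notation q := (#|G|%:R : int).

(** The coefficient at [v] of the inner product of column [k] of matrix [i] with column [l] of
    matrix [j], taken in the group ring of [G]. *)
Definition agree (i j : I) (k l v : G) : int :=
  \sum_b ((H i b k - H j b l) == v)%:R.

Hypothesis H_hadamard : {in J, forall i b b' k k',
  H i b k - H i b' k = H i b k' - H i b' k' -> b = b' \/ k = k'}.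
(** Translation by [e] multiplies a character sum by a phase, so all inner products between two
    bases have the same modulus. *)
Hypothesis H_unbiased : {in J &, forall i j, i != j ->
  forall k l k' l', exists e, forall v, agree i j k l v = agree i j k' l' (v + e)}.

Lemma sum_agree i j k l : \sum_v agree i j k l v = q.
Proof.
rewrite exchange_big /=; under eq_bigr do rewrite sum_eq1.
by rewrite sum_cst mulr1.
Qed.

(** The autocorrelation of [agree i j k l], dual to the squared modulus of the inner product; a
    translation of [agree] cancels in it. *)
Definition acorr (i j : I) (k l u : G) : int :=
  \sum_b \sum_b' ((H i b k - H j b l) - (H i b' k - H j b' l) == u)%:R.

Lemma acorrE i j k l u :
  acorr i j k l u = \sum_v agree i j k l (u + v) * agree i j k l v.
Proof.
under [RHS]eq_bigr do rewrite /agree mulr_sumr.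
rewrite /acorr exchange_big [RHS]exchange_big /=; apply: eq_bigr => b' _.
rewrite [RHS](bigD1 (H i b' k - H j b' l)) //= eqxx mulr1.
rewrite [X in _ = _ + X]big1 ?addr0; last first.
  by move=> v /negPf; rewrite eq_sym => ->; rewrite mulr0.
by apply: eq_bigr => b _; rewrite subr_eq.
Qed.

Lemma acorr_unbiased i j k l k' l' u : i \in J -> j \in J -> i != j ->
  acorr i j k l u = acorr i j k' l' u.
Proof.
move=> iJ jJ ij; have [e He] := H_unbiased iJ jJ ij k l k' l'.
rewrite !acorrE [RHS](reindex_inj (addIr e)) /=.
by apply: eq_bigr => v _; rewrite !He addrA.
Qed.

Lemma sum_acorr i j k l : \sum_u acorr i j k l u = q ^+ 2.
Proof.
under eq_bigr do rewrite acorrE.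
rewrite exchange_big /=.
transitivity (\sum_v q * agree i j k l v); last first.
  by rewrite -mulr_sumr sum_agree expr2.
apply: eq_bigr => v _; rewrite -mulr_suml; congr (_ * _).
by rewrite -(sum_agree i j k l) [RHS](reindex_inj (addIr v)).
Qed.

Local Notation h i k := (H i 0 k - H i 1 k).

Lemma h_inj i : i \in J -> injective (fun k => h i k).
Proof.
move=> iJ k k' /(H_hadamard iJ) [] // /eqP.
by rewrite eq_sym oner_eq0.
Qed.

(* Entry [(b, b', a)] of the projection of [e_0 e_1^*] to the span of the
   projections of basis [i], up to a constant; [a] is the Fourier dual of the character. *)
Definition match_count (i : I) (t : G * G * G) : int :=
  \sum_k (H i t.1.1 k - H i t.1.2 k + t.2 == h i k)%:R.

Lemma sum_trip (f : G * G * G -> int) :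
  \sum_t f t = \sum_b \sum_b' \sum_a f (b, b', a).
Proof.
rewrite pair_big_dep /= pair_big_dep /=.
by apply: eq_bigr => [[[a b] c]] _.
Qed.

Lemma sum_match i b b' : \sum_a match_count i (b, b', a) = q.
Proof.
rewrite exchange_big /=.
transitivity (\sum_(k : G) (1 : int)); last by rewrite sum_cst mulr1.
apply: eq_bigr => k _; rewrite -[RHS](sum_eq1l (h i k - (H i b k - H i b' k))).
by apply: eq_bigr => a _; rewrite [in RHS]eq_sym subr_eq addrC eq_sym.
Qed.

(** For fixed [b], [b'], [k], [l] the condition of [i] determines [a]; substituting it in the
    condition of [j] leaves the one counted by [acorr]. *)
Lemma match_mul i j : \sum_t match_count i t * match_count j t =
  \sum_k \sum_l acorr i j k l (h i k - h j l).
Proof.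
rewrite sum_trip /match_count /=.
transitivity (\sum_b \sum_b' \sum_a \sum_k \sum_l
   ((H i b k - H i b' k + a == h i k)%:R *
   (H j b l - H j b' l + a == h j l)%:R : int)).
  do 3!(apply: eq_bigr => ? _); rewrite mulr_suml.
  by apply: eq_bigr => k _; rewrite mulr_sumr.
transitivity (\sum_b \sum_b' \sum_k \sum_l
   ((H i b k - H j b l - (H i b' k - H j b' l) == h i k - h j l)%:R : int)).
  apply: eq_bigr => b _; apply: eq_bigr => b' _.
  rewrite exchange_big /=; apply: eq_bigr => k _.
  rewrite exchange_big /=; apply: eq_bigr => l _.
  rewrite (bigD1 (h i k - (H i b k - H i b' k))) //= [X in X == h i k]addrC subrK eqxx mul1r.
  rewrite big1 ?addr0; last first.
    move=> a; rewrite eq_sym subr_eq [X in _ != X]addrC eq_sym => /negPf ->.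
    by rewrite mul0r.
  congr (nat_of_bool _)%:R.
  apply/eqP/eqP; move: (h i k) (h j l) => u v.
    by move=> <-; ring.
  move=> /eqP; rewrite subr_eq => /eqP E.
  have -> : u = H i b k - H j b l - (H i b' k - H j b' l) + v.
    by rewrite E; ring.
  by ring.
rewrite /acorr; pose e b b' k l : int :=
  (H i b k - H j b l - (H i b' k - H j b' l) == h i k - h j l)%:R.
transitivity (\sum_b \sum_k \sum_b' \sum_l (e b b' k l : int)).
  by apply: eq_bigr => b _; exact: exchange_big.
rewrite exchange_big /=; apply: eq_bigr => k _.
transitivity (\sum_b \sum_l \sum_b' (e b b' k l : int)).
  by apply: eq_bigr => b _; exact: exchange_big.
exact: exchange_big.
Qed.


Lemma acorr_diag i k : acorr i i k k 0 = q ^+ 2.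
Proof.
transitivity (\sum_(b : G) \sum_(b' : G) (1 : int)).
  by do 2!(apply: eq_bigr => ? _); rewrite !subrr eqxx.
by rewrite !sum_cst mulr1 expr2.
Qed.

(** The difference of two distinct columns is a bijection of [G], so every [b'] has exactly one
    partner [b]. *)
Lemma acorr_offdiag i k l u : i \in J -> k != l -> acorr i i k l u = q.
Proof.
move=> iJ kl.
have D_inj : injective (fun b => H i b k - H i b l).
  move=> b b' E; case: (H_hadamard iJ (b := b) (b' := b') (k := k) (k' := l)) => //.
    have -> : H i b k = H i b' k - H i b' l + H i b l by rewrite -E; ring.
    by ring.
  by move=> E'; rewrite E' eqxx in kl.
rewrite /acorr exchange_big /=.
transitivity (\sum_(b : G) (1 : int)); last by rewrite sum_cst mulr1.
apply: eq_bigr => b' _.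
rewrite -[RHS](sum_eq1l (u + (H i b' k - H i b' l))).
rewrite [RHS](reindex_inj D_inj) /=.
by apply: eq_bigr => b _; rewrite subr_eq.
Qed.

Lemma match_norm i : i \in J ->
  \sum_t match_count i t * match_count i t = 2 * q ^+ 3 - q ^+ 2.
Proof.
move=> iJ; rewrite match_mul.
transitivity (\sum_(k : G) (q ^+ 2 + (q - 1) * q)); last by rewrite sum_cst; ring.
apply: eq_bigr => k _; rewrite (bigD1 k) //= subrr acorr_diag; congr (_ + _).
transitivity (\sum_(l | l != k) q).
  by apply: eq_bigr => l lk; rewrite acorr_offdiag // eq_sym.
rewrite sumr_const.
have -> : #|G|%:R - 1 = #|predC1 k|%:R :> int.
  by rewrite (cardC1 k) -subn1 natrB //; apply/card_gt0P; exists k.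
by rewrite mulr_natl.
Qed.

(** [acorr] does not depend on the columns, and for fixed [l] the shift [h i k - h j l] runs over
    [G] with [k]; the inner sum is thus the total [q ^+ 2]. *)
Lemma match_orth i j : i \in J -> j \in J -> i != j ->
  \sum_t match_count i t * match_count j t = q ^+ 3.
Proof.
move=> iJ jJ ij; rewrite match_mul exchange_big /=.
transitivity (\sum_(l : G) q ^+ 2); last by rewrite sum_cst; ring.
apply: eq_bigr => l _; rewrite -(sum_acorr i j 0 0).
have inj : injective (fun k => h i k - h j l).
  by move=> k k' /addIr /(h_inj iJ).
rewrite [RHS](reindex_inj inj) /=; apply: eq_bigr => k _.
exact: acorr_unbiased.
Qed.

(** By [sum_match] the mean over [a] is [1]; subtracting it removes the trivial character. *)
Let excess i t := match_count i t - 1.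
(** The matrix unit at [(0, 1)]; the factor [q * (a == 0) - 1] is the sum of all nontrivial
    characters at [a]. *)
Let target (t : G * G * G) : int :=
  (t.1 == (0, 1))%:R * (q * (t.2 == 0)%:R - 1).

Lemma sum_match_all i : \sum_t match_count i t = q ^+ 3.
Proof.
rewrite sum_trip; under eq_bigr do under eq_bigr do rewrite sum_match.
by under eq_bigr do rewrite sum_cst; rewrite sum_cst; ring.
Qed.

Lemma excess_mul i j : i \in J -> j \in J ->
  \sum_t excess i t * excess j t = (i == j)%:R * (q ^+ 3 - q ^+ 2).
Proof.
move=> iJ jJ.
transitivity (\sum_t (match_count i t * match_count j t -
   match_count i t - match_count j t + 1)).
  by apply: eq_bigr => t _; rewrite /excess; ring.
rewrite !big_split /= !sumrN !sum_match_all sum_cst !card_prod !natrM.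
by case: eqVneq => [<-|ij] /=; rewrite ?match_norm ?match_orth // ?mulr1n ?mulr0n; ring.
Qed.

Lemma target_sum (f : G * G * G -> int) :
  \sum_t f t * target t = q * f (0, 1, 0) - \sum_a f (0, 1, a).
Proof.
transitivity (\sum_a f (0, 1, a) * (q * (a == 0)%:R - 1)).
  transitivity (\sum_c \sum_a f (c, a) * target (c, a)).
    by rewrite pair_big_dep; apply: eq_bigr => [[]].
  rewrite (bigD1 (0, 1)) //= [X in _ + X]big1 ?addr0; last first.
    by move=> c /negPf c01; rewrite big1 // => a _; rewrite /target /= c01 mul0r mulr0.
  by apply: eq_bigr => a _; rewrite /target /= eqxx mul1r.
transitivity (\sum_a (q * (f (0, 1, a) * (a == 0)%:R) - f (0, 1, a))).
  by apply: eq_bigr => a _; ring.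
rewrite big_split /= sumrN -mulr_sumr; congr (_ * _ - _).
rewrite (bigD1 0) //= eqxx mulr1 big1 ?addr0 // => a /negPf ->.
by rewrite mulr0.
Qed.

Lemma excess_target i : \sum_t excess i t * target t = q * (q - 1).
Proof.
rewrite target_sum /excess sumrB sum_match sum_cst.
have -> : match_count i (0, 1, 0) = q.
  rewrite /match_count /= -[RHS]mulr1 -sum_cst; apply: eq_bigr => k _.
  by rewrite addr0 eqxx.
by ring.
Qed.

Lemma target_norm : \sum_t target t * target t = q * (q - 1).
Proof.
have T a : target (0, 1, a) = q * (a == 0)%:R - 1.
  by rewrite /target /= eqxx mul1r.
rewrite target_sum T eqxx mulr1; under eq_bigr do rewrite T.
by rewrite sumrB -mulr_sumr sum_eq1l sum_cst; ring.
Qed.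

(* Bessel's inequality: the [excess i] are orthogonal with the same norm and
   the same inner product with [target]. *)
Theorem unbiased_hadamard_bound : (#|J| <= #|G|)%N.
Proof.
pose m := #|J|%:R : int.
(* As [excess i] and [target] have the same inner product with [target], [m * target] is the
   orthogonal projection of the sum of the [excess i]. The squared distance is
   [m * q * (q - 1) * (q - m)]. *)
have S_ge0 : 0 <= \sum_t (\sum_(i in J) excess i t - m * target t) ^+ 2.
  by apply: sumr_ge0 => t _; exact: sqr_ge0.
have SE : \sum_t (\sum_(i in J) excess i t - m * target t) ^+ 2 =
  m * (q ^+ 3 - q ^+ 2) - m ^+ 2 * (q * (q - 1)).
  transitivity (\sum_t (\sum_(i in J) \sum_(j in J) excess i t * excess j t
     - 2 * m * (\sum_(i in J) excess i t * target t)
     + m ^+ 2 * (target t * target t))).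
    apply: eq_bigr => t _; rewrite -mulr_suml.
    under [X in _ = X - _ + _]eq_bigr do rewrite -mulr_sumr.
    by rewrite -mulr_suml; ring.
  rewrite !big_split /= sumrN -!mulr_sumr target_norm.
  rewrite [X in X - _ + _]exchange_big [X in _ - _ * X + _]exchange_big /=.
  have -> : \sum_(i in J) \sum_t excess i t * target t = m * (q * (q - 1)).
    by rewrite (eq_bigr _ (fun i _ => excess_target i)) sumr_const [RHS]mulr_natl.
  have -> : \sum_(i in J) \sum_t \sum_(j in J) excess i t * excess j t =
     m * (q ^+ 3 - q ^+ 2).
    rewrite /m mulr_natl -sumr_const; apply: eq_bigr => i iJ.
    rewrite exchange_big /= (bigD1 i) //= excess_mul // eqxx mul1r big1 ?addr0 //.
    by move=> j /andP[jJ /negPf ji]; rewrite excess_mul // eq_sym ji mul0r.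
  by ring.
have q_gt1 : 1 < q.
  rewrite ltr1n; apply/card_gt1P; exists 0, 1; split=> //.
  by rewrite eq_sym oner_neq0.
have [->|m_gt0] := posnP #|J|; first exact: leq0n.
have {}m_gt0 : 0 < m by rewrite ltr0n.
rewrite -(ler_nat int) -/m leNgt; apply/negP => qm.
have : m * (q ^+ 3 - q ^+ 2) - m ^+ 2 * (q * (q - 1)) < 0.
  have -> : m * (q ^+ 3 - q ^+ 2) - m ^+ 2 * (q * (q - 1)) =
    - (m * (q * (q - 1)) * (m - q)) by ring.
  rewrite oppr_lt0 !mulr_gt0 ?subr_gt0 //.
  exact: lt_trans ltr01 q_gt1.
by rewrite -SE ltNge S_ge0.
Qed.

End UnbiasedHadamard.

(** * Colorings whose fibers are [C_p wr C_p] *)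

Lemma Zp_gen (p : nat) (g h : 'Z_p) : prime p -> g != 0 -> exists n, h = g *+ n.
Proof.
move=> pp g0; exists (nat_of_ord (h / g)).
have gU : g \is a GRing.unit.
  rewrite -(natr_Zp g) unitZpE ?prime_gt1 // prime_coprime //.
  apply/negP => /dvdn_leq; rewrite lt0n => /(_ g0).
  by rewrite leqNgt -[X in (_ < X)%N](Zp_cast (prime_gt1 pp)) ltn_ord.
by rewrite -mulr_natr natr_Zp mulrC divrK.
Qed.

Section WreathColoring.

Variables (Omega K : finType) (col : Omega -> Omega -> K) (p : nat).
Hypothesis p_prime : prime p.

Hypothesis col_diag : forall x y z, col x y = col z z -> x = y.
Hypothesis col_conv : forall x y x' y',
  col x y = col x' y' -> col y x = col y' x'.
Hypothesis col_count : forall x y x' y', col x y = col x' y' -> forall s t,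
  #|[set z | (col x z == s) && (col z y == t)]| =
  #|[set z | (col x' z == s) && (col z y' == t)]|.

Definition same_fiber x y := col x x == col y y.
Local Infix "~~~" := same_fiber (at level 70).

(* The relation of [C_p wr C_p] containing [(u, v)]; [inr 0] is not used. *)
Definition wreath_color (u v : 'Z_p * 'Z_p) : 'Z_p + 'Z_p :=
  if u.2 == v.2 then inl (v.1 - u.1) else inr (v.2 - u.2).

Variable coord : Omega -> 'Z_p * 'Z_p.
Hypothesis coord_inj : forall x y, x ~~~ y -> coord x = coord y -> x = y.
Hypothesis coord_surj : forall x u, exists2 y, x ~~~ y & coord y = u.
Hypothesis coord_col : forall x y x' y', x ~~~ y -> x ~~~ x' -> x ~~~ y' ->
  (col x y == col x' y') =
  (wreath_color (coord x) (coord y) == wreath_color (coord x') (coord y')).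
Hypothesis col_valency : forall x y, ~~ (x ~~~ y) ->
  #|[set z | col x z == col x y]| = p.

Local Notation G := ('Z_p : finComNzRingType).

Lemma card_G : #|G| = p.
Proof. by rewrite card_ord Zp_cast ?prime_gt1. Qed.

(** * Fibers and the translation action of ['Z_p] *)

Lemma fiberxx x : x ~~~ x. Proof. exact: eqxx. Qed.
Lemma fiberC x y : (x ~~~ y) = (y ~~~ x). Proof. exact: eq_sym. Qed.
Lemma fiber_trans y x z : x ~~~ y -> y ~~~ z -> x ~~~ z.
Proof. by rewrite /same_fiber => /eqP ->. Qed.
Lemma fiber_eql x y z : x ~~~ y -> (x ~~~ z) = (y ~~~ z).
Proof. by rewrite /same_fiber => /eqP ->. Qed.
Lemma fiber_eqr x y z : x ~~~ y -> (z ~~~ x) = (z ~~~ y).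
Proof. by rewrite /same_fiber => /eqP ->. Qed.

(** Coherence in its working form: a positive number of two-step paths stays positive for every pair
    of the same color. *)
Lemma col_path x y x' y' z : col x y = col x' y' ->
  exists2 z', col x' z' = col x z & col z' y' = col z y.
Proof.
move=> E; have := col_count E (col x z) (col z y).
have : z \in [set t | (col x t == col x z) && (col t y == col z y)].
  by rewrite inE !eqxx.
move=> zin card_eq; have : (0 < #|[set t | (col x' t == col x z) && (col t y' == col z y)]|)%N.
  by rewrite -card_eq; apply/card_gt0P; exists z.
by case/card_gt0P=> z'; rewrite inE => /andP[/eqP ? /eqP ?]; exists z'.
Qed.

Lemma col_fiberl x y x' y' : col x y = col x' y' -> x ~~~ x'.
Proof.
move=> /(col_path x) [z' E _]; apply/eqP.
by have zx := col_diag E; rewrite -{}zx in E.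
Qed.

Lemma col_fiberr x y x' y' : col x y = col x' y' -> y ~~~ y'.
Proof. by move=> /col_conv/col_fiberl. Qed.

Lemma col_exr x x' y : x ~~~ x' -> exists2 y', y ~~~ y' & col x' y' = col x y.
Proof.
by move=> /eqP/(col_path y) [y' E _]; exists y' => //; apply: (col_fiberr (esym E)).
Qed.

Lemma col_exl y y' x : y ~~~ y' -> exists2 x', x ~~~ x' & col x' y' = col x y.
Proof. by move=> /(col_exr x) [x' xx' /col_conv E]; exists x'. Qed.

(* The default [x] is never returned, by [coord_surj]. *)
Definition act (g : G) (x : Omega) : Omega :=
  odflt x [pick y | (x ~~~ y) && (coord y == ((coord x).1 + g, (coord x).2))].

Lemma actP g x :
  x ~~~ act g x /\ coord (act g x) = ((coord x).1 + g, (coord x).2).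
Proof.
rewrite /act; case: pickP => [y /andP[xy /eqP]//|no].
have [y xy cy] := coord_surj x ((coord x).1 + g, (coord x).2).
by have := no y; rewrite xy cy eqxx.
Qed.

Lemma fiber_act g x : x ~~~ act g x. Proof. by case: (actP g x). Qed.
Lemma coord_act g x : coord (act g x) = ((coord x).1 + g, (coord x).2).
Proof. by case: (actP g x). Qed.

Lemma fiber_actl g x y : (act g x ~~~ y) = (x ~~~ y).
Proof. by rewrite -(fiber_eql _ (fiber_act g x)). Qed.
Lemma fiber_actr g x y : (x ~~~ act g y) = (x ~~~ y).
Proof. by rewrite fiberC fiber_actl fiberC. Qed.

Lemma act0 x : act 0 x = x.
Proof.
apply: coord_inj; first by rewrite fiber_actl fiberxx.
by rewrite coord_act addr0; case: (coord x).
Qed.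

Lemma act_add g h x : act g (act h x) = act (g + h) x.
Proof.
apply: coord_inj; first by rewrite !fiber_actl fiber_actr fiberxx.
by rewrite !coord_act /= -addrA [h + g]addrC.
Qed.

Lemma actC g h x : act g (act h x) = act h (act g x).
Proof. by rewrite !act_add addrC. Qed.

Lemma actK g : cancel (act g) (act (- g)).
Proof. by move=> x; rewrite act_add addNr act0. Qed.

Lemma actNK g : cancel (act (- g)) (act g).
Proof. by move=> x; rewrite act_add subrr act0. Qed.

Lemma act_injl x : injective (act^~ x).
Proof.
move=> g h E; have := congr1 (fun z => (coord z).1) E.
by rewrite /= !coord_act /= => /addrI.
Qed.

Definition same_block x y := (x ~~~ y) && ((coord x).2 == (coord y).2).

Lemma same_blockP x y : reflect (exists g, y = act g x) (same_block x y).
Proof.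
apply: (iffP andP) => [[xy /eqP E]|[g ->]]; last first.
  by rewrite fiber_act coord_act eqxx.
exists ((coord y).1 - (coord x).1); apply: coord_inj.
  by rewrite fiber_actr fiberC.
by rewrite coord_act addrC subrK E; case: (coord y).
Qed.

Lemma col_act_thin g x x' y :
  x ~~~ x' -> col x' y = col x (act g x) -> y = act g x'.
Proof.
move=> xx' E; have yx := col_fiberr E; rewrite fiber_actr in yx.
have x'y : x' ~~~ y by rewrite -(fiber_eql _ xx') fiberC.
apply: coord_inj; first by rewrite fiber_actr fiberC.
move/eqP: E; rewrite coord_col //; try by rewrite ?fiber_actr fiberC.
rewrite /wreath_color !coord_act /= eqxx [_ + g]addrC addrK.
case: ifP => [/eqP e2|_] /eqP E; last by [].
have <- : (coord y).1 - (coord x').1 = g by case: E.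
by rewrite addrC subrK e2; case: (coord y).
Qed.

(** Transport the path [x], [act g y], [y]: its last step is thin, which forces the new middle
    point. So translations act on colors. *)
Lemma col_actr g x y x' y' :
  col x y = col x' y' -> col x (act g y) = col x' (act g y').
Proof.
move=> E; have yy' := col_fiberr E.
have [z E1 E2] := col_path (act g y) E.
by rewrite -E1 (col_act_thin yy' (col_conv E2)).
Qed.

Lemma col_actl g x y x' y' :
  col x y = col x' y' -> col (act g x) y = col (act g x') y'.
Proof. by move=> /col_conv/(col_actr g)/col_conv. Qed.

Lemma col_act_diff_block g x y : x ~~~ y -> ~~ same_block x y ->
  col x (act g y) = col x y.
Proof.
rewrite /same_block => xy; rewrite xy /= => /negPf xyN.
apply/eqP; rewrite coord_col ?fiber_actr ?fiberxx //.
by rewrite /wreath_color !coord_act /= xyN.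
Qed.

Lemma card_fiber x : #|[set z | x ~~~ z]| = (p ^ 2)%N.
Proof.
rewrite -(card_in_imset (f := coord)); last first.
  move=> y z; rewrite !inE => xy xz; apply: coord_inj.
  by rewrite -(fiber_eql _ xy).
have -> : [set coord z | z in [set z | x ~~~ z]] = [set: G * G].
  apply/setP => u; rewrite inE; apply/imsetP.
  by have [y xy <-] := coord_surj x u; exists y => //; rewrite inE.
by rewrite cardsT card_prod card_G expnS expn1.
Qed.

(** * Blocky and transversal neighbourhoods *)

Definition blocky x y := [forall g, col x (act g y) == col x y].

Lemma blocky_act x y g : blocky x y -> col x (act g y) = col x y.
Proof. by move/forallP/(_ g)/eqP. Qed.

(** The translations fixing a color form a subgroup of ['Z_p], which is trivial or everything
    because [p] is prime. *)
Lemma nblocky_inj x y g h : ~~ blocky x y ->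
  col x (act g y) = col x (act h y) -> g = h.
Proof.
move=> nb E; apply/eqP; apply: contraNT nb; rewrite -subr_eq0 => gh.
have {}E : col x (act (g - h) y) = col x y.
  by have := col_actr (- h) E; rewrite actK act_add addrC.
apply/forallP => f; have [n ->] := Zp_gen f p_prime gh.
elim: n => [|n /eqP IH]; first by rewrite mulr0n act0.
by rewrite mulrS -act_add -E; apply/eqP/col_actr.
Qed.

Lemma blocky_memP x y z : ~~ (x ~~~ y) -> blocky x y ->
  (col x z == col x y) = same_block y z.
Proof.
move=> xy bxy.
have /eqP E : [set act g y | g : G] == [set z | col x z == col x y].
  rewrite eqEcard; apply/andP; split.
    by apply/subsetP => _ /imsetP[g _ ->]; rewrite inE blocky_act.
  by rewrite col_valency // card_imset ?card_G //; exact: act_injl.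
transitivity (z \in [set z | col x z == col x y]); first by rewrite inE.
rewrite -E; apply/imsetP/same_blockP => [[g _ ->]|[g ->]]; by exists g.
Qed.

(** The [p] translates of the neighbourhood of [x] are disjoint and have [p] points each, so they
    fill the fiber of [p ^ 2] points. *)
Lemma nblocky_ex x y z : ~~ (x ~~~ y) -> ~~ blocky x y -> y ~~~ z ->
  exists g, col x (act g z) = col x y.
Proof.
move=> xy nb yz.
pose R := [set z | col x z == col x y].
pose f (t : Omega * G) := act t.2 t.1.
have /eqP E : [set f t | t in setX R [set: G]] == [set w | y ~~~ w].
  rewrite eqEcard; apply/andP; split.
    apply/subsetP => _ /imsetP[[w g] /setXP[wR _] ->]; rewrite !inE in wR *.
    by rewrite /f fiber_actr /=; apply: col_fiberr (esym (eqP wR)).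
  rewrite card_in_imset; first by rewrite cardsX col_valency // cardsT card_G card_fiber.
  move=> [w g] [w' g'] /setXP[wR _] /setXP[w'R _]; rewrite /f /= => Ef.
  rewrite !inE in wR w'R.
  have gg' : g = g'.
    apply: (nblocky_inj nb).
    by rewrite -(col_actr g (eqP wR)) -(col_actr g' (eqP w'R)) Ef.
  by rewrite -gg' in Ef *; rewrite (can_inj (actK g) Ef).
have : z \in [set w | y ~~~ w] by rewrite inE.
rewrite -E => /imsetP[[w g] /setXP[wR _] ->]; rewrite inE in wR.
by exists (- g); rewrite /f /= actK; apply/eqP.
Qed.

Lemma blockyr x y y' : ~~ (x ~~~ y) -> y ~~~ y' -> blocky x y -> blocky x y'.
Proof.
move=> xy yy' b; apply: contraT => nb.
have xy' : ~~ (x ~~~ y') by rewrite -(fiber_eqr _ yy').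
have [g] := nblocky_ex xy' nb (etrans (fiberC _ _) yy').
rewrite blocky_act // => E; case/negP: nb; apply/forallP => h.
by rewrite -(col_actr h E) blocky_act // E.
Qed.

Lemma blocky_fiber x y x' y' : ~~ (x ~~~ y) -> x ~~~ x' -> y ~~~ y' ->
  blocky x y = blocky x' y'.
Proof.
have main u v u' v' : ~~ (u ~~~ v) -> u ~~~ u' -> v ~~~ v' -> blocky u v -> blocky u' v'.
  move=> uv uu' vv' b; have [w vw E] := col_exr v uu'.
  apply: (@blockyr _ w).
  - by rewrite -(fiber_eql _ uu') -(fiber_eqr _ vw).
  - by rewrite -(fiber_eql _ vw).
  by apply/forallP => g; rewrite (col_actr g E) E blocky_act.
move=> xy xx' yy'; apply/idP/idP; first exact: main.
apply: main; [|by rewrite fiberC..].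
by rewrite -(fiber_eql _ xx') -(fiber_eqr _ yy').
Qed.

Lemma other_block x : exists2 y, x ~~~ y & ~~ same_block x y.
Proof.
have [y xy cy] := coord_surj x (0, (coord x).2 + 1).
exists y => //; rewrite /same_block xy cy /=.
by rewrite eq_sym -subr_eq0 addrC addKr oner_eq0.
Qed.

Lemma same_block_actr x y g : same_block x (act g y) = same_block x y.
Proof. by rewrite /same_block fiber_actr coord_act. Qed.

(** For [x1] in another block than [x], the pairs [(x, x1)] and [(x, act 1 x1)] have the same color.
    Transporting the path through [y] keeps the middle point in the block of [y], and blockiness
    seen from [act 1 x1] brings it back to [y]. So [y] does not separate [x1] from [act 1 x1]. *)
Lemma blocky_sym x y : ~~ (x ~~~ y) -> blocky x y -> blocky y x.
Proof.
move=> xy b; apply: contraT => nb.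
have yx : ~~ (y ~~~ x) by rewrite fiberC.
have [w xw nxw] := other_block x.
have [g E] := nblocky_ex yx nb xw.
set x1 := act g w in E.
have xx1 : x ~~~ x1 by rewrite fiber_actr.
have nxx1 : ~~ same_block x x1 by rewrite same_block_actr.
have [y' E1 E2] := col_path y (esym (col_act_diff_block 1 xx1 nxx1)).
have /same_blockP[h def_y'] : same_block y y' by rewrite -(blocky_memP _ xy) // E1.
have b1 : blocky (act 1 x1) y.
  by rewrite -(blocky_fiber (x := x) (y := y)) // ?fiber_actr ?fiberxx.
have E3 : col y (act 1 x1) = col y x1.
  by rewrite -E2; apply: col_conv; rewrite def_y' blocky_act.
have nb1 : ~~ blocky y x1 by rewrite -(blocky_fiber (x := y) (y := x)) // fiberxx.
have := @nblocky_inj y x1 1 0 nb1; rewrite act0 => /(_ E3)/eqP.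
by rewrite oner_eq0.
Qed.

Lemma nblocky_sym x y : ~~ (x ~~~ y) -> ~~ blocky x y -> ~~ blocky y x.
Proof. by move=> xy; apply: contra; apply: blocky_sym; rewrite fiberC. Qed.

Lemma col_convE x y x' y' : (col x y == col x' y') = (col y x == col y' x').
Proof. by apply/eqP/eqP; exact: col_conv. Qed.

Lemma sum_nblocky x y z : ~~ (x ~~~ y) -> ~~ blocky x y -> y ~~~ z ->
  (\sum_(g : G) (if col x (act g z) == col x y then 1 else 0) = 1)%N.
Proof.
move=> xy nb yz; have [g0 E0] := nblocky_ex xy nb yz.
have nbz : ~~ blocky x z.
  by rewrite -(blocky_fiber (x := x) (y := y)) // fiberxx.
rewrite (bigD1 g0) //= E0 eqxx big1 ?addn0 // => g gg0.
by case: eqP => // E; case/eqP: gg0; apply: (nblocky_inj nbz); rewrite E E0.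
Qed.

(* The count is the same for all translates of [x'], and their sum counts each
   neighbour [z] of [x] once, since [z] sees one translate of [x'] in the
   color of [x]. *)
Lemma line_unique x y x' : ~~ (x ~~~ y) -> ~~ blocky x y -> x ~~~ x' ->
  ~~ same_block x x' ->
  #|[set z | (col x z == col x y) && (col x' z == col x y)]| = 1%N.
Proof.
move=> xy nb xx' nxx'.
pose N g := #|[set z | (col x z == col x y) && (col (act g x') z == col x y)]|.
have Ncst g : N g = N 0.
  rewrite /N act0.
  have := col_count (col_act_diff_block g xx' nxx') (col x y) (col y x).
  move=> E; rewrite (eq_card (B := [set z | (col x z == col x y) && (col z (act g x') == col y x)])).
    rewrite E; apply: eq_card => z.
    by rewrite !inE [col z x' == _]col_convE.
  by move=> z; rewrite !inE [col z _ == _]col_convE.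
have sumN : (\sum_g N g = p)%N.
  rewrite -[RHS](col_valency xy) -sum1dep_card.
  rewrite (eq_bigr (fun g => \sum_(z | col x z == col x y)
     (if col (act g x') z == col x y then 1 else 0)))%N; last first.
    by move=> g _; rewrite /N -sum1dep_card big_mkcondr.
  rewrite exchange_big /=; apply: eq_bigr => z /eqP Ez.
  have zx : ~~ (z ~~~ x) by rewrite (fiber_eql _ (col_fiberr Ez)) fiberC.
  have nbz : ~~ blocky z x.
    apply: nblocky_sym; first by rewrite fiberC.
    rewrite -(blocky_fiber (x := x) (y := y)) ?fiberxx // fiberC.
    exact: col_fiberr Ez.
  rewrite -[RHS](sum_nblocky zx nbz xx'); apply: eq_bigr => g _.
  by rewrite -Ez [X in if X then _ else _]col_convE.
move/eqP: sumN; rewrite (eq_bigr _ (fun g _ => Ncst g)) sum_nat_const card_G.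
rewrite -[X in _ == X]muln1 eqn_pmul2l ?prime_gt0 // => /eqP <-.
by rewrite /N act0.
Qed.

(** * Transitivity of both kinds *)

Lemma blocky_trans x y z : ~~ (x ~~~ y) -> ~~ (y ~~~ z) -> ~~ (x ~~~ z) ->
  blocky x y -> blocky y z -> blocky x z.
Proof.
move=> xy yz xz bxy byz.
have /eqP E : [set w | col x w == col x z] == [set act g z | g : G].
  rewrite eqEcard; apply/andP; split; last first.
    by rewrite col_valency // card_imset ?card_G //; exact: act_injl.
  apply/subsetP => w; rewrite inE => /eqP Ew.
  have [y' E1 E2] := col_path y (esym Ew).
  have : same_block y y' by rewrite -(blocky_memP _ xy) // E1.
  case/same_blockP=> h def_y'.
  have E3 : col y' z = col y z.
    by apply: col_conv; rewrite def_y' blocky_act // blocky_sym.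
  have y'z : ~~ (y' ~~~ z) by rewrite def_y' fiber_actl.
  have by'z : blocky y' z.
    by rewrite -(blocky_fiber (x := y) (y := z)) ?fiberxx // def_y' fiber_act.
  have : same_block z w by rewrite -(blocky_memP _ y'z) // E2 E3.
  by case/same_blockP=> g ->; apply/imsetP; exists g.
apply/forallP => g.
have : act g z \in [set act g z | g : G] by apply/imsetP; exists g.
by rewrite -E inE.
Qed.

(** If [(x, z)] were blocky, averaging over translates would give each [z'] in the fiber of [z]
    exactly one path from [x] in the colors of [(x, y)] and [(y, z)]. But two neighbours [y], [y2]
    of [x] in distinct blocks have a common neighbour, which gives two paths. *)
Lemma nblocky_trans x y z : ~~ (x ~~~ y) -> ~~ (y ~~~ z) -> ~~ (x ~~~ z) ->
  ~~ blocky x y -> ~~ blocky y z -> ~~ blocky x z.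
Proof.
move=> xy yz xz nxy nyz; apply/negP => bxz.
pose N z' := #|[set y' | (col x y' == col x y) && (col y' z' == col y z)]|.
have N1 z' : z ~~~ z' -> N z' = 1%N.
  move=> zz'.
  have Ncst g : N (act g z') = N z'.
    apply: col_count; apply: blocky_act.
    by rewrite -(blocky_fiber (x := x) (y := z)) ?fiberxx.
  have sumN : (\sum_(g : G) N (act g z') = p)%N.
    rewrite -[RHS](col_valency xy) -sum1dep_card.
    rewrite (eq_bigr (fun g => \sum_(y' | col x y' == col x y)
       (if col y' (act g z') == col y z then 1 else 0)))%N; last first.
      by move=> g _; rewrite /N -sum1dep_card big_mkcondr.
    rewrite exchange_big /=; apply: eq_bigr => y' /eqP Ey'.
    have y'y := col_fiberr Ey'; rewrite fiberC in y'y.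
    have [w zw Ew] := col_exr z y'y.
    have y'w : ~~ (y' ~~~ w) by rewrite -(fiber_eql _ y'y) -(fiber_eqr _ zw).
    have ny'w : ~~ blocky y' w by rewrite -(blocky_fiber (x := y) (y := z)).
    rewrite -Ew; apply: sum_nblocky => //.
    by rewrite -(fiber_eql _ zw).
  move/eqP: sumN; rewrite (eq_bigr _ (fun g _ => Ncst g)) sum_nat_const card_G.
  by rewrite -[X in _ == X]muln1 eqn_pmul2l ?prime_gt0 // => /eqP.
have [w yw nyw] := other_block y.
have [g Eg] := nblocky_ex xy nxy yw.
set y2 := act g w in Eg.
have yy2 : y ~~~ y2 by rewrite fiber_actr.
have nyy2 : ~~ same_block y y2 by rewrite same_block_actr.
have /eqP/cards1P[z' Ez'] := line_unique yz nyz yy2 nyy2.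
have : z' \in [set z'] by rewrite inE.
rewrite -Ez' inE => /andP[/eqP E1 /eqP E2].
have /eqP/cards1P[u Eu] := N1 z' (col_fiberr (esym E1)).
have yu : y \in [set u] by rewrite -Eu inE E1 !eqxx.
have y2u : y2 \in [set u] by rewrite -Eu inE E2 Eg !eqxx.
move: yu y2u nyy2; rewrite !inE => /eqP -> /eqP ->.
by rewrite /same_block fiberxx eqxx.
Qed.

(** By the two transitivity lemmas no triangle of fibers mixes both kinds; every pair is reached
    through the fiber of [x0]. *)
Lemma nblocky_all x0 y0 : ~~ (x0 ~~~ y0) -> ~~ blocky x0 y0 ->
  forall x y, ~~ (x ~~~ y) -> ~~ blocky x y.
Proof.
move=> xy0 nb0.
have step z : ~~ (x0 ~~~ z) -> ~~ blocky x0 z.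
  move=> xz; case y0z: (y0 ~~~ z).
    by rewrite -(blocky_fiber (x := x0) (y := y0)) // fiberxx.
  move/negbT: y0z => y0z.
  apply/negP => bxz; case byz: (blocky y0 z); last first.
    by move/negP: (nblocky_trans xy0 y0z xz nb0 (negbT byz)).
  case/negP: nb0; apply: (@blocky_trans x0 z y0) => //; first by rewrite fiberC.
  exact: blocky_sym.
move=> x y xy; case xx0: (x0 ~~~ x).
  rewrite -(blocky_fiber (x := x0) (y := y)) ?fiberxx //.
    by apply: step; rewrite (fiber_eql _ xx0).
  by rewrite (fiber_eql _ xx0).
move/negbT: xx0 => x0x.
have nxx0 : ~~ blocky x x0 by apply: nblocky_sym => //; exact: step.
have xx0 : ~~ (x ~~~ x0) by rewrite fiberC.
case yx0: (x0 ~~~ y).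
  by rewrite -(blocky_fiber (x := x) (y := x0)) ?fiberxx.
by apply: (@nblocky_trans x x0 y) => //; [rewrite yx0|apply: step; rewrite yx0].
Qed.

(** * Generalized Hadamard matrices from transversal relations *)

Section Transversal.

Hypothesis nblocky : forall x y, ~~ (x ~~~ y) -> ~~ blocky x y.

Lemma shift_ex x y x' y' : ~~ (x ~~~ y) -> x ~~~ x' -> y ~~~ y' ->
  exists g, col (act g x') y' = col x y.
Proof.
move=> xy xx' yy'; have [x2 xx2 E] := col_exl x yy'.
have y'x2 : ~~ (y' ~~~ x2).
  by rewrite fiberC -(fiber_eql _ xx2) -(fiber_eqr _ yy').
have x2x' : x2 ~~~ x' by rewrite -(fiber_eql _ xx2).
have [g Eg] := nblocky_ex y'x2 (nblocky y'x2) x2x'.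
by exists g; rewrite (col_conv Eg).
Qed.

Lemma shift_uniq x y g h : ~~ (x ~~~ y) ->
  col (act g x) y = col (act h x) y -> g = h.
Proof.
move=> xy /col_conv; apply: nblocky_inj; apply: nblocky.
by rewrite fiberC.
Qed.

(** One pair determines [h]. Any other pair has the color of [(x, act k y)] for some [k], and
    translations commute. *)
Lemma shift_transfer x y g : ~~ (x ~~~ y) -> exists h, forall x' y',
  x ~~~ x' -> y ~~~ y' -> col (act g x') y' = col x' (act h y').
Proof.
move=> xy; have yx : ~~ (y ~~~ x) by rewrite fiberC.
have gx : x ~~~ act g x by exact: fiber_act.
have [h Eh] : exists h, col (act h y) x = col y (act g x).
  by apply: shift_ex; rewrite ?fiber_actr ?fiber_actl ?fiberxx.
exists h => x' y' xx' yy'.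
have [k Ek] : exists k, col (act k y) x = col y' x'.
  apply: shift_ex; try by rewrite fiberC.
  by rewrite -(fiber_eql _ yy') -(fiber_eqr _ xx').
have {}Ek := col_conv Ek.
rewrite -(col_actl g Ek) -(col_actr h Ek) actC.
by apply: col_actr; apply: col_conv.
Qed.

Variable x0 : Omega.

(** Fibers are named by their diagonal color. The default [x0] is not reached for [c] in
    [other_fibers]. *)
Definition rep (c : K) := odflt x0 [pick y | col y y == c].
Definition pt x u := odflt x [pick y | (x ~~~ y) && (coord y == u)].
Definition other_fibers := [set col y y | y in [set y | ~~ (x0 ~~~ y)]].

Lemma repP c : c \in other_fibers ->
  col (rep c) (rep c) = c /\ ~~ (x0 ~~~ rep c).
Proof.
case/imsetP=> y; rewrite inE => xy ->; rewrite /rep.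
case: pickP => [z /eqP E|/(_ y)]; last by rewrite eqxx.
by split=> //; rewrite /same_fiber E.
Qed.

Lemma ptP x u : x ~~~ pt x u /\ coord (pt x u) = u.
Proof.
rewrite /pt; case: pickP => [y /andP[? /eqP]//|no].
by have [y xy cy] := coord_surj x u; have := no y; rewrite xy cy eqxx.
Qed.

Lemma fiber_pt x u : x ~~~ pt x u. Proof. by case: (ptP x u). Qed.
Lemma coord_pt x u : coord (pt x u) = u. Proof. by case: (ptP x u). Qed.

(* [offset c b k] tells in which translate of the base relation the base points
   of block [b] of the fiber of [x0] and of block [k] of the fiber [c] lie. *)
Definition offset c (b k : G) : G := odflt 0
  [pick g | col (act (- g) (pt x0 (0, b))) (pt (rep c) (0, k)) == col x0 (rep c)].

Lemma offsetE c b k g : c \in other_fibers ->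
  (col (act (- g) (pt x0 (0, b))) (pt (rep c) (0, k)) == col x0 (rep c)) =
  (g == offset c b k).
Proof.
move=> cJ; have [Ec xc] := repP cJ.
have uniq g' : col (act (- g') (pt x0 (0, b))) (pt (rep c) (0, k)) = col x0 (rep c) ->
    (col (act (- g) (pt x0 (0, b))) (pt (rep c) (0, k)) == col x0 (rep c)) = (g == g').
  move=> E; apply/eqP/eqP => [E'|->//]; apply: oppr_inj.
  apply: (@shift_uniq (pt x0 (0, b)) (pt (rep c) (0, k))); last by rewrite E E'.
  by rewrite -(fiber_eql _ (fiber_pt _ _)) -(fiber_eqr _ (fiber_pt _ _)).
rewrite /offset; case: pickP => [g' /eqP /uniq //|no].
have [g' E] := shift_ex xc (fiber_pt x0 (0, b)) (fiber_pt (rep c) (0, k)).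
by have := no (- g'); rewrite opprK E eqxx.
Qed.

Lemma offset_col c b k : c \in other_fibers ->
  col (act (- offset c b k) (pt x0 (0, b))) (pt (rep c) (0, k)) = col x0 (rep c).
Proof. by move=> cJ; apply/eqP; rewrite offsetE. Qed.

Lemma offset_hadamard : {in other_fibers, forall c b b' k k',
  offset c b k - offset c b' k = offset c b k' - offset c b' k' ->
  b = b' \/ k = k'}.
Proof.
move=> c cJ b b' k k' E; have [Ec xc] := repP cJ.
have [->|bb'] := eqVneq b b'; [by left|right].
set r := col x0 (rep c).
have [fb fb'] := (fiber_pt x0 (0, b), fiber_pt x0 (0, b')).
have [fk fk'] := (fiber_pt (rep c) (0, k), fiber_pt (rep c) (0, k')).
set x := pt x0 (0, b) in fb *; set x' := pt x0 (0, b') in fb' *.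
set y := pt (rep c) (0, k) in fk *; set y' := pt (rep c) (0, k') in fk' *.
pose X := act (- offset c b k) x; pose X' := act (- offset c b' k) x'.
pose g := offset c b k - offset c b k'.
have gE : g = offset c b' k - offset c b' k'.
  rewrite /g; have -> : offset c b k = offset c b k' - offset c b' k' + offset c b' k.
    by rewrite -E subrK.
  by ring.
(* By [gE] the same [g] turns the offsets for [k] into those for [k'] in both blocks [b] and [b'].
   Hence a single [h] makes [y] and [act h y'] common neighbours of [X] and [X'], and [line_unique]
   identifies them. *)
have [h hP] := shift_transfer g xc.
have X0 : x0 ~~~ X by rewrite fiber_actr.
have X'0 : x0 ~~~ X' by rewrite fiber_actr.
have EX : col X y = r by exact: offset_col.
have EX' : col X' y = r by exact: offset_col.
have EXh : col X (act h y') = r.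
  rewrite -hP // /X act_add /g addrAC subrr add0r; exact: offset_col.
have EXh' : col X' (act h y') = r.
  rewrite -hP // /X' act_add gE addrAC subrr add0r; exact: offset_col.
have XX' : X ~~~ X' by rewrite -(fiber_eql _ X0).
have nXX' : ~~ same_block X X'.
  by rewrite /same_block !coord_act !coord_pt /= negb_and bb' orbT.
have Xy : ~~ (X ~~~ y) by rewrite -(fiber_eql _ X0) -(fiber_eqr _ fk).
have /eqP/cards1P[u Eu] := line_unique Xy (nblocky Xy) XX' nXX'.
have yu : y \in [set u] by rewrite -Eu inE EX EX' eqxx.
have y'u : act h y' \in [set u] by rewrite -Eu inE EX EXh EXh' eqxx.
move: yu y'u; rewrite !inE => /eqP <- /eqP /(congr1 (fun z => (coord z).2)).
by rewrite coord_act !coord_pt.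
Qed.

(** An intersection number through the fiber of [x0] with the first relation twisted by [v]: [agree]
    without coordinates. *)
Definition common c d y y' v := #|[set x |
  (col (act (- v) x) y == col x0 (rep c)) && (col x y' == col x0 (rep d))]|.

(** The count depends only on the color of [(y, y')]. A translate of [z] produces that color, and
    [shift_transfer] turns this translation into a shift of [v]. *)
Lemma common_shift c d y y' z z' : c \in other_fibers -> d \in other_fibers ->
  c != d -> rep c ~~~ y -> rep d ~~~ y' -> rep c ~~~ z -> rep d ~~~ z' ->
  exists e, forall v, common c d y y' v = common c d z z' (v + e).
Proof.
move=> cJ dJ cd cy dy' cz dz'.
have [[Ec xc] [Ed xd]] := (repP cJ, repP dJ).
have ncd : ~~ (rep c ~~~ rep d) by rewrite /same_fiber Ec Ed.
have yy' : ~~ (y ~~~ y') by rewrite -(fiber_eql _ cy) -(fiber_eqr _ dy').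
have [g Eg] : exists g, col (act g z) z' = col y y'.
  apply: shift_ex => //; first by rewrite -(fiber_eql _ cy).
  by rewrite -(fiber_eql _ dy').
have cx : ~~ (rep c ~~~ x0) by rewrite fiberC.
have [h hP] := shift_transfer g cx.
exists (- h) => v.
have moveE x w : (col (act (- v) x) w == col x0 (rep c)) =
    (col w x == col (rep c) (act v x0)).
  rewrite [RHS]col_convE; apply/eqP/eqP => [/(col_actl v)|/(col_actl (- v))].
    by rewrite actNK.
  by rewrite actK.
transitivity (common c d (act g z) z' v).
  have := col_count (esym Eg) (col (rep c) (act v x0)) (col x0 (rep d)).
  by rewrite /common => E; under eq_finset do rewrite moveE;
     under [in RHS]eq_finset do rewrite moveE.
apply: eq_card => x; rewrite !inE.
case: (boolP (col x z' == _)) => [/eqP Ex|]; rewrite ?andbF // !andbT.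
have x0x : x0 ~~~ x by exact: col_fiberl (esym Ex).
rewrite opprD opprK addrC -act_add.
have Ey := hP z (act (- v) x) cz; rewrite fiber_actr in Ey.
by rewrite (col_conv (Ey x0x)).
Qed.

(** The neighbours of the base point of block [l] meet each block [b] of the fiber of [x0] in the
    single point [f b], where the condition on [c] compares the two offsets. *)
Lemma agree_common c d k l v : c \in other_fibers -> d \in other_fibers ->
  agree offset c d k l v =
  (common c d (pt (rep c) (0, k)) (pt (rep d) (0, l)) v)%:R.
Proof.
move=> cJ dJ.
have -> : agree offset c d k l v =
    #|[set b | offset c b k - offset d b l == v]|%:R.
  rewrite -sum1dep_card natr_sum big_mkcond /=; apply: eq_bigr => b _.
  by case: eqP.
congr (_%:R); pose f b := act (- offset d b l) (pt x0 (0, b)).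
have fE b : (col (act (- v) (f b)) (pt (rep c) (0, k)) == col x0 (rep c)) =
    (offset c b k - offset d b l == v).
  by rewrite /f act_add -opprD offsetE // eq_sym subr_eq.
rewrite /common -(card_imset (f := f)); last first.
  by move=> b b' /(congr1 (fun z => (coord z).2)); rewrite !coord_act !coord_pt.
apply: eq_card => x; rewrite inE; apply/imsetP/andP => [[b bin ->]|[E1 E2]].
  by rewrite inE in bin; rewrite fE bin offset_col.
have x0x : x0 ~~~ x by exact: col_fiberl (esym (eqP E2)).
pose b := (coord x).2.
have xE : x = act (coord x).1 (pt x0 (0, b)).
  apply: coord_inj.
    by rewrite fiber_actr -(fiber_eql _ x0x) fiber_pt.
  by rewrite coord_act coord_pt /= add0r /b; case: (coord x).
have xf : x = f b.
  rewrite /f; have := E2; rewrite {1}xE -[(coord x).1]opprK offsetE // => /eqP <-.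
  by rewrite opprK -xE.
by exists b => //; rewrite inE -fE -xf.
Qed.

Lemma offset_unbiased : {in other_fibers &, forall c d, c != d ->
  forall k l k' l', exists e, forall v,
  agree offset c d k l v = agree offset c d k' l' (v + e)}.
Proof.
move=> c d cJ dJ cd k l k' l'.
have [e He] := common_shift cJ dJ cd (fiber_pt (rep c) (0, k))
  (fiber_pt (rep d) (0, l)) (fiber_pt (rep c) (0, k')) (fiber_pt (rep d) (0, l')).
by exists e => v; rewrite !agree_common // He.
Qed.

Lemma transversal_bound : (#|Omega| <= p ^ 2 * (p + 1))%N.
Proof.
have Jp : (#|other_fibers| <= p)%N.
  rewrite -[X in (_ <= X)%N]card_G.
  exact: unbiased_hadamard_bound offset_hadamard offset_unbiased.
pose S := [set col y y | y : Omega].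
(* The extra [1] is the fiber of [x0] itself. *)
have SJ : (#|S| <= p + 1)%N.
  apply: (@leq_trans #|col x0 x0 |: other_fibers|).
    apply/subset_leq_card/subsetP => _ /imsetP[y _ ->]; rewrite !inE.
    case: eqVneq => //= E; apply/imsetP; exists y => //.
    by rewrite inE /same_fiber eq_sym.
  by rewrite cardsU1 addnC; apply: leq_add => //; case: (_ \notin _).
rewrite -cardsT -sum1_card (partition_big (fun y => col y y) (mem S)) /=; last first.
  by move=> y _; apply/imsetP; exists y.
apply: (@leq_trans (\sum_(c in S) p ^ 2)%N).
  apply: leq_sum => c /imsetP[y _ ->]; rewrite -(card_fiber y) -sum1dep_card.
  rewrite leq_eqVlt; apply/orP; left; apply/eqP; apply: eq_bigl => z.
  by rewrite inE /same_fiber eq_sym.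
by rewrite sum_nat_const mulnC leq_mul2l SJ orbT.
Qed.

End Transversal.

(** The second alternative is [s s* s = s] read along a path [x], [y], [z], [w]. *)
Theorem coloring_dichotomy : (#|Omega| <= p ^ 2 * (p + 1))%N \/
  forall x y z w, col x y = col z y -> col z y = col z w -> col x w = col x y.
Proof.
have [all_b|] := boolP [forall x, forall y, (x ~~~ y) || blocky x y]; last first.
  case/forallPn=> x /forallPn[y]; rewrite negb_or => /andP[xy nb]; left.
  exact: transversal_bound (nblocky_all xy nb) x.
right=> x y z w E1 E2.
have xz := col_fiberl E1; have yw := col_fiberr E2.
have [xy|nxy] := boolP (x ~~~ y); last first.
  have bxy : blocky x y.
    by move/forallP: all_b => /(_ x)/forallP/(_ y); rewrite (negPf nxy).
  have nzy : ~~ (z ~~~ y) by rewrite -(fiber_eql _ xz).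
  have bzy : blocky z y by rewrite -(blocky_fiber (x := x) (y := y)) ?fiberxx.
  have : same_block y w by rewrite -(blocky_memP _ nzy) // E2.
  by case/same_blockP=> g ->; rewrite blocky_act.
(* Inside a fiber the claim is checked in the coordinates of [C_p wr C_p]. *)
have xw := fiber_trans xy yw.
have zy : z ~~~ y by rewrite -(fiber_eql _ xz).
have zw : z ~~~ w by rewrite -(fiber_eql _ xz).
move/eqP: E1; move/eqP: E2; rewrite !coord_col ?fiberxx //.
move=> E2 E1; apply/eqP; rewrite coord_col ?fiberxx //.
move: E1 E2; rewrite /wreath_color.
case: (coord x) (coord y) (coord z) (coord w) => [x1 x2] [y1 y2] [z1 z2] [w1 w2] /=.
have inlE (a b : G) : (inl a == inl b :> G + G) = (a == b) by [].
have inrE (a b : G) : (inr a == inr b :> G + G) = (a == b) by [].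
case: (eqVneq x2 y2) => [->|xy2]; case: (eqVneq z2 y2) => [->|zy2] //.
- rewrite inlE (inj_eq (addrI _)) eqr_opp => /eqP ->.
  case: (eqVneq y2 w2) => // _.
  by rewrite !inlE (inj_eq (addIr _)) => /eqP ->.
- rewrite inrE (inj_eq (addrI _)) eqr_opp => /eqP ->.
  case: (eqVneq z2 w2) => // _.
  by rewrite inrE (inj_eq (addIr _)) => /eqP <-; rewrite inrE.
Qed.

End WreathColoring.

(** * Coherent configurations as colorings *)

Section ColorOfConfiguration.

Variables (Omega : finType) (C : coherent_configuration Omega).

Definition color (x y : Omega) : {set Omega * Omega} := pblock (rels C) (x, y).

Let trivC : trivIset (rels C).
Proof. by case/and3P: (rels_partition C). Qed.

Let in_cover (q : Omega * Omega) : q \in cover (rels C).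
Proof. by case/and3P: (rels_partition C) => /eqP -> _ _; rewrite inE. Qed.

Lemma color_rels x y : color x y \in rels C.
Proof. exact: pblock_mem. Qed.

Lemma mem_rels s x y : s \in rels C -> ((x, y) \in s) = (color x y == s).
Proof.
move=> sC; apply/idP/eqP => [xy|<-]; first exact: def_pblock.
by rewrite mem_pblock.
Qed.

Lemma mem_color x y : (x, y) \in color x y.
Proof. by rewrite mem_rels ?color_rels. Qed.

Lemma rels_color s : s \in rels C -> exists x y, s = color x y.
Proof.
move=> sC; have /set0Pn[[x y] xy] : s != set0.
  apply/eqP => s0; case/and3P: (rels_partition C) => _ _.
  by rewrite -s0 sC.
by exists x, y; apply/esym/eqP; rewrite -mem_rels.
Qed.

Lemma color_diag x y z : color x y = color z z -> x = y.
Proof.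
move=> E; have [T TC covT] := rels_diag C.
have : (z, z) \in cover T by rewrite -covT; apply/imsetP; exists z.
case/bigcupP=> t tT zt; have tC := subsetP TC t tT.
have : (x, y) \in t by rewrite mem_rels // E -mem_rels.
move=> xyt; have : (x, y) \in cover T by apply/bigcupP; exists t.
by rewrite -covT => /imsetP[w _ [-> ->]].
Qed.

Lemma conv_color x y : conv_rel (color x y) = color y x.
Proof.
apply/esym/eqP; rewrite -mem_rels ?rels_conv ?color_rels //.
by rewrite inE mem_color.
Qed.

Lemma color_conv x y x' y' : color x y = color x' y' -> color y x = color y' x'.
Proof. by move=> E; rewrite -conv_color E conv_color. Qed.

Lemma intnumE s t x y : s \in rels C -> t \in rels C ->
  #|[set z | (color x z == s) && (color z y == t)]| = intnum C s t (color x y).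
Proof.
move=> sC tC; apply/eqP; rewrite -(eqr_nat int).
have /matrixP/(_ (enum_rank x) (enum_rank y)) := rels_mul sC tC.
rewrite mxE summxE (reindex (@enum_rank Omega)) /=; last first.
  exact/onW_bij/enum_rank_bij.
rewrite (bigD1 (color x y)) ?color_rels //= [X in _ + X]big1; last first.
  move=> u /andP[uC]; rewrite eq_sym => uxy.
  by rewrite mulmxnE mxE !enum_rankK mem_rels // (negPf uxy) mul0rn.
rewrite mulmxnE mxE !enum_rankK mem_color addr0 => <-.
rewrite -sum1dep_card natr_sum big_mkcond /=; apply/eqP/eq_bigr => z _.
rewrite !mxE !enum_rankK !mem_rels //.
by case: (color x z == s); case: (color z y == t).
Qed.

Lemma color_count x y x' y' : color x y = color x' y' -> forall s t,
  #|[set z | (color x z == s) && (color z y == t)]| =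
  #|[set z | (color x' z == s) && (color z y' == t)]|.
Proof.
have no a b u : u \notin rels C -> (color a b == u) = false.
  by apply: contraNF => /eqP <-; exact: color_rels.
move=> E s t; have [sC|sC] := boolP (s \in rels C); last first.
  by apply: eq_card => z; rewrite !inE ![color _ _ == s]no.
have [tC|tC] := boolP (t \in rels C); last first.
  by apply: eq_card => z; rewrite !inE ![color z _ == t]no ?andbF.
by rewrite !intnumE // E.
Qed.

Lemma complex_prodP (T U : {set {set Omega * Omega}}) x y :
  T \subset rels C -> U \subset rels C ->
  reflect (exists z, color x z \in T /\ color z y \in U)
    (color x y \in complex_prod C T U).
Proof.
move=> TC UC; rewrite inE color_rels /=; apply: (iffP exists_inP).
  case=> t tT /exists_inP[u uU].
  rewrite -(intnumE x y (subsetP TC t tT) (subsetP UC u uU)) => /card_gt0P[z].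
  by rewrite inE => /andP[/eqP xz /eqP zy]; exists z; rewrite xz zy.
case=> z [xz zy]; exists (color x z) => //; apply/exists_inP.
exists (color z y) => //; rewrite -intnumE ?color_rels //.
by apply/card_gt0P; exists z; rewrite inE !eqxx.
Qed.

Definition fiber_of (x : Omega) : {set Omega} := [set y | color x x == color y y].

Lemma diag_fiber_of x : diag_rel (fiber_of x) = color x x.
Proof.
apply/setP => [[a b]]; rewrite [RHS]mem_rels ?color_rels //.
apply/imsetP/eqP => [[z zx [-> ->]]|E]; first by rewrite inE in zx; apply/esym/eqP.
have ab := color_diag E; rewrite -ab in E *.
by exists a => //; rewrite inE E.
Qed.

Lemma fiber_fiber_of x : fiber C (fiber_of x).
Proof. by rewrite /fiber diag_fiber_of color_rels. Qed.

(** The middle point of a composable pair would lie in both fibers. This makes the [p ^ 3]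
    hypothesis available between distinct fibers. *)
Lemma color_mul_self x y : color x x != color y y ->
  adjmx (color x y) *m adjmx (color x y) = 0.
Proof.
move=> xy; apply/matrixP => i j; rewrite !mxE big1 // => k _.
rewrite !mxE !mem_rels ?color_rels //.
case: eqP => [E1|_]; last by rewrite mul0r.
case: eqP => [E2|_]; last by rewrite mulr0.
case/negP: xy; have := col_fiberr color_diag color_conv color_count E1.
have := col_fiberl color_diag color_count E2.
by rewrite /same_fiber => /eqP -> /eqP ->.
Qed.

Lemma card_rel x y :
  #|color x y| = (#|fiber_of x| * #|[set z | color x z == color x y]|)%N.
Proof.
rewrite -sum1_card (partition_big fst (mem (fiber_of x))) /=; last first.
  move=> [a b]; rewrite mem_rels ?color_rels // => /eqP /esym E.
  by rewrite inE; exact: (col_fiberl color_diag color_count E).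
rewrite -sum_nat_const; apply: eq_bigr => a; rewrite inE => /eqP xa.
(* Written as closed paths at [x], the valency depends only on the color of [(x, x)]. *)
transitivity #|[set z | (color x z == color x y) && (color z x == color y x)]|.
  rewrite (color_count xa) -sum1dep_card.
  rewrite (reindex (fun z => (a, z))) /=; last first.
    exists snd => [z _|[b z]] //=; rewrite unfold_in /= => /andP[_ /eqP ->] //.
  apply: eq_bigl => z; rewrite mem_rels ?color_rels // eqxx andbT.
  apply/idP/andP => [|[]//] /eqP E; rewrite E eqxx; split=> //.
  by apply/eqP/color_conv.
apply: eq_card => z; rewrite !inE; apply/andP/idP => [[]//|/eqP E].
by rewrite E eqxx (color_conv E).
Qed.

End ColorOfConfiguration.

(** * From wreath product fibers to colorings *)

Lemma wreath_relsP (p : nat) (R : {set ('Z_p * 'Z_p) * ('Z_p * 'Z_p)}) :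
  R \in wreath_rels p ->
  exists c, forall u v, ((u, v) \in R) = (wreath_color u v == c).
Proof.
rewrite /wreath_color; case/setUP => /imsetP[a aP ->]; [exists (inl a)|exists (inr a)].
  move=> [u1 u2] [v1 v2] /=; apply/imsetP/idP => [[[z1 z2] _] /= [-> -> -> ->]|].
    by rewrite eqxx [z1 + a]addrC addrK.
  case: (eqVneq u2 v2) => [->|//] E; exists (u1, v2) => //=.
  have /eqP <- : v1 - u1 == a := E.
  by rewrite addrC subrK.
rewrite !inE in aP.
move=> [u1 u2] [v1 v2] /=; apply/imsetP/idP => [[[[z1 z2] z3] _] /= [-> -> -> ->]|].
  by rewrite -subr_eq0 opprD addNKr oppr_eq0 (negPf aP) addrC addKr.
case: (eqVneq u2 v2) => [//|_] E; exists ((u1, v1), u2) => //=.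
have /eqP <- : v2 - u2 == a := E.
by rewrite addrC subrK.
Qed.

Theorem theorem1p2 (p : nat) (Omega : finType)
    (C : coherent_configuration Omega)
    (p_prime : prime p)
    (fibers_wreath : forall Delta : {set Omega}, fiber C Delta ->
       scheme_iso Delta (rels_in C Delta)
         [set: 'Z_p * 'Z_p] (wreath_rels p))
    (card_rels : forall s : {set Omega * Omega}, s \in rels C ->
       adjmx s *m adjmx s = 0 -> #|s| = (p ^ 3)%N) :
  (#|Omega| <= p ^ 2 * (p + 1))%N \/
  (forall s : {set Omega * Omega}, s \in rels C ->
     complex_prod C (complex_prod C [set s] [set conv_rel s]) [set s]
     = [set s]).
Proof.
(* The constant map on sets that are not fibers makes the statement total, so that finite choice
   yields one family of isomorphisms. *)
have iso_ex Delta : exists f : Omega -> 'Z_p * 'Z_p, fiber C Delta ->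
    [/\ {in Delta &, injective f}, f @: Delta = [set: 'Z_p * 'Z_p] &
        [set [set (f q.1, f q.2) | q in r] |
          r : {set Omega * Omega} in rels_in C Delta] = wreath_rels p].
  have [fD|nfD] := boolP (fiber C Delta); last by exists (fun=> 0).
  by have [f] := fibers_wreath _ fD; exists f.
have [f fP] := fin_all_exists iso_ex.
pose col := color C; pose coord x := f (fiber_of C x) x.
have fiber_eq x y : same_fiber col x y -> fiber_of C x = fiber_of C y.
  by move=> /eqP xy; apply/setP => z; rewrite !inE -[color C x x]/(col x x) xy.
have coord_inj x y : same_fiber col x y -> coord x = coord y -> x = y.
  move=> xy; rewrite /coord -(fiber_eq _ _ xy).
  have [inj _ _] := fP _ (fiber_fiber_of C x).
  by apply: inj; rewrite inE ?eqxx.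
have coord_surj x u : exists2 y, same_fiber col x y & coord y = u.
  have [_ surj _] := fP _ (fiber_fiber_of C x).
  have : u \in f (fiber_of C x) @: fiber_of C x by rewrite surj inE.
  case/imsetP=> y; rewrite inE => xy ->; exists y => //.
  by rewrite /coord -(fiber_eq _ _ xy).
have coord_col x y x' y' : same_fiber col x y -> same_fiber col x x' ->
    same_fiber col x y' -> (col x y == col x' y') =
    (wreath_color (coord x) (coord y) == wreath_color (coord x') (coord y')).
  move=> xy xx' xy'; have [inj _ im] := fP _ (fiber_fiber_of C x).
  rewrite /coord -(fiber_eq _ _ xy) -(fiber_eq _ _ xx') -(fiber_eq _ _ xy').
  set D := fiber_of C x in inj im *; set g := f D in inj im *.
  pose R := [set (g q.1, g q.2) | q in col x y].
  have subD a b : (a, b) \in col x y -> (a \in D) /\ (b \in D).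
    rewrite (mem_rels _ _ (color_rels C x y)) => /eqP /esym E; rewrite !inE; split.
      exact: (col_fiberl (@color_diag _ C) (@color_count _ C) E).
    rewrite (eqP (xy : color C x x == color C y y)).
    exact: (col_fiberr (@color_diag _ C) (@color_conv _ C) (@color_count _ C) E).
  have RW : R \in wreath_rels p.
    rewrite -im; apply/imsetP; exists (col x y) => //; rewrite inE color_rels /=.
    by apply/subsetP => [[a b] /subD[aD bD]]; rewrite inE /= aD.
  (* The image of a relation is a level set of [wreath_color], so equal colors can be compared in
     coordinates. *)
  have [c cP] := wreath_relsP RW.
  have inR a b : a \in D -> b \in D -> ((g a, g b) \in R) = ((a, b) \in col x y).
    move=> aD bD; apply/imsetP/idP => [[[a' b'] abin /= [E1 E2]]|abin].
      have [a'D b'D] := subD _ _ abin.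
      by rewrite (inj _ _ aD a'D E1) (inj _ _ bD b'D E2).
    by exists (a, b).
  have [xD yD x'D y'D] : [/\ x \in D, y \in D, x' \in D & y' \in D].
    by rewrite !inE eqxx; split.
  have : (g x, g y) \in R by rewrite inR // mem_color.
  rewrite cP => /eqP ->; rewrite [RHS]eq_sym -cP inR //.
  rewrite (mem_rels _ _ (color_rels C x y)).
  exact: eq_sym.
have col_valency x y : ~~ same_fiber col x y ->
    #|[set z | col x z == col x y]| = p.
  move=> xy; have := card_rels _ (color_rels C x y) (color_mul_self xy).
  rewrite card_rel -[#|fiber_of C x|]/#|[set z | same_fiber col x z]|.
  (* Cancelling the [p ^ 2] points of the fiber from [p ^ 3] leaves the valency [p]. *)
  rewrite (card_fiber p_prime coord_inj coord_surj) (expnSr p 2) => /eqP.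
  by rewrite eqn_pmul2l ?expn_gt0 ?prime_gt0 // => /eqP.
have [bound|closed] := coloring_dichotomy p_prime (@color_diag _ C)
  (@color_conv _ C) (@color_count _ C) coord_inj coord_surj coord_col col_valency.
  by left.
right=> s sC; have [x [y def_s]] := rels_color sC.
have s1C : [set s] \subset rels C by rewrite sub1set.
have cs1C : [set conv_rel s] \subset rels C by rewrite sub1set rels_conv.
have ppC : complex_prod C [set s] [set conv_rel s] \subset rels C.
  by apply/subsetP => u; rewrite inE => /andP[].
apply/setP => u; rewrite in_set1; apply/idP/eqP => [uP|->].
  have uC : u \in rels C by move: uP; rewrite inE => /andP[].
  have [a [b def_u]] := rels_color uC; rewrite def_u in uP *.
  case/complex_prodP: uP => // d [/complex_prodP[] // e [ae ed] db].
  rewrite !inE in ae ed db; move/eqP: ae => ae.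
  move: ed; rewrite -ae conv_color => /eqP/color_conv ed.
  rewrite -ae in db *.
  exact: closed (esym ed) (etrans ed (esym (eqP db))).
(* The degenerate path [x], [y], [x], [y] shows that [s] itself occurs. *)
rewrite def_s in s1C cs1C ppC *; apply/complex_prodP => //; exists x.
split; last by rewrite inE.
apply/complex_prodP => //; exists y; split; first by rewrite inE.
by rewrite inE conv_color.
Qed.
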